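(* Let $X$ be a real Banach space. If the bidual $X^{**}$ is a GL-space, then $X$ has the Mazur-Ulam property.
   Context: For a real Banach space $X$, $B_X$ is the closed unit ball, $S_X$ the unit sphere, $X^*$ the dual. For $x^*\in S_{X^*}$ and $\varepsilon>0$ put $S(x^*,\varepsilon)=\{x\in B_X: x^*(x)>1-\varepsilon\}$, and $-S(x^*,\varepsilon)=\{-x: x\in S(x^*,\varepsilon)\}$. For $A\subseteq X$, $\operatorname{d}(x,A)$ is the distance from $x$ to $A$. $X$ is called a generalised lush (GL) space if for every $x\in S_X$ and every $\varepsilon>0$ there is $x^*\in S_{X^*}$ such that $x\in S(x^*,\varepsilon)$ and $\operatorname{d}(y,S(x^*,\varepsilon))+\operatorname{d}(y,-S(x^*,\varepsilon))<2+\varepsilon$ for all $y\in S_X$. A real Banach space $X$ has the Mazur-Ulam property (MUP) if for every real Banach space $Y$, every bijective isometry (distance-preserving map) between $S_X$ and $S_Y$ can be extended to a linear isometry between $X$ and $Y$. *)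

(* Defs.v *)
From HB Require Import structures.
From mathcomp Require Import all_boot all_order all_algebra.
From mathcomp Require Import all_classical all_reals all_analysis.

Set Implicit Arguments.
Unset Strict Implicit.
Unset Printing Implicit Defensive.

Import Order.TTheory GRing.Theory Num.Theory.
Import numFieldNormedType.Exports.

Local Open Scope classical_set_scope.
Local Open Scope ring_scope.

Definition unit_ball (R : realType) (X : normedModType R) : set X :=
  [set x | `|x| <= 1].

Definition unit_sphere (R : realType) (X : normedModType R) : set X :=
  [set x | `|x| = 1].

Arguments unit_ball {R} X.
Arguments unit_sphere {R} X.

(* The scalar field as a normed module over itself is written R^o. *)
Definition dual_pred (R : realType) (X : normedModType R) : {pred X -> R^o} :=
  fun f => `[< linear f /\ continuous f >].

Lemma dual_predP (R : realType) (X : normedModType R) (f : X -> R^o) :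
  reflect (linear f /\ continuous f) (f \in @dual_pred R X).
Proof. exact: asboolP. Qed.

Section DualSpaceTheory.
Context (R : realType) (X : normedModType R).

Record dual_space := DualSpace { dual_fun :> X -> R^o ; _ : dual_fun \in @dual_pred R X }.

HB.instance Definition _ := [isSub for dual_fun].
HB.instance Definition _ := [Choice of dual_space by <:].

Lemma dual_submod_closed : submod_closed (@dual_pred R X).
Proof.
split=> [|a f g /dual_predP[lf cf] /dual_predP[lg cg]]; apply/dual_predP.
  split; last exact: cst_continuous.
  by move=> a x y /=; rewrite scaler0 addr0.
split=> [b x y|x].
  by rewrite /= !fctE lf lg !scalerDr !scalerA mulrC addrACA.
by apply: cvgD; [apply: cvgZr; exact: cf | exact: cg].
Qed.

HB.instance Definition _ :=
  GRing.isSubmodClosed.Build R (X -> R^o) (@dual_pred R X) dual_submod_closed.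
HB.instance Definition _ := [SubChoice_isSubLmodule of dual_space by <:].

Lemma dual_linear (f : dual_space) : linear f.
Proof. by case: f => f /= /dual_predP[]. Qed.

HB.instance Definition _ (f : dual_space) :=
  GRing.isLinear.Build R X R^o _ f (dual_linear f).

Lemma dual_continuous (f : dual_space) : continuous f.
Proof. by case: f => f /= /dual_predP[]. Qed.

Lemma dualP (f g : dual_space) : f =1 g -> f = g.
Proof. by move=> fg; apply/val_inj/funext. Qed.

Definition dual_norm (f : dual_space) : R := sup [set `|f x| | x in unit_ball X].

Lemma dual_has_sup (f : dual_space) : has_sup [set `|f x| | x in unit_ball X].
Proof.
split; first by exists `|f 0|, 0 => //; rewrite /unit_ball /= normr0.
have /linear_boundedP/pinfty_ex_gt0[M M0 fM] : bounded_near f (nbhs 0).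
  by apply/linear_bounded_continuous/dual_continuous.
exists M => _ [x x1 <-]; apply: (le_trans (fM x)).
by rewrite ler_piMr// ltW.
Qed.

Lemma dual_norm_ub (f : dual_space) x : `|x| <= 1 -> `|f x| <= dual_norm f.
Proof.
by move=> x1; apply: (ub_le_sup (proj2 (dual_has_sup f))); exists x.
Qed.

Lemma dual_norm_le (f : dual_space) M :
  (forall x, `|x| <= 1 -> `|f x| <= M) -> dual_norm f <= M.
Proof.
move=> fM; apply: ge_sup; first exact: (proj1 (dual_has_sup f)).
by move=> _ [x /fM ? <-].
Qed.

Lemma dual_norm_ge0 (f : dual_space) : 0 <= dual_norm f.
Proof. by apply: le_trans (@dual_norm_ub f 0 _); rewrite ?normr0. Qed.

Lemma le_dual_norm (f : dual_space) x : `|f x| <= dual_norm f * `|x|.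
Proof.
have [->|x0] := eqVneq x 0; first by rewrite linear0 !normr0 mulr0.
have nx0 : 0 < `|x| by rewrite normr_gt0.
have := @dual_norm_ub f (`|x|^-1 *: x).
rewrite normrZ gtr0_norm ?invr_gt0// mulVf ?gt_eqF// => /(_ (lexx _)).
by rewrite linearZ/= normrM gtr0_norm ?invr_gt0// ler_pdivrMl// mulrC.
Qed.

Lemma dual_norm_triangle (f g : dual_space) :
  dual_norm (f + g) <= dual_norm f + dual_norm g.
Proof.
apply: dual_norm_le => x x1.
by apply: (le_trans (ler_normD (f x) (g x))); rewrite lerD ?dual_norm_ub.
Qed.

Lemma dual_normZ (a : R) (f : dual_space) : dual_norm (a *: f) = `|a| * dual_norm f.
Proof.
have le_normZ (b : R) (h : dual_space) : dual_norm (b *: h) <= `|b| * dual_norm h.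
  apply: dual_norm_le => x x1.
  have -> : (b *: h) x = b * h x by [].
  by rewrite normrM ler_wpM2l ?dual_norm_ub.
apply/eqP; rewrite eq_le le_normZ /=.
have [->|a0] := eqVneq a 0; first by rewrite normr0 mul0r dual_norm_ge0.
rewrite -ler_pdivlMl ?normr_gt0//.
by rewrite -normfV -{1}(scalerK a0 f) le_normZ.
Qed.

Lemma dual_norm0_eq0 (f : dual_space) : dual_norm f = 0 -> f = 0.
Proof.
move=> f0; apply: dualP => x; apply/eqP; rewrite -normr_le0.
by apply: (le_trans (le_dual_norm f x)); rewrite f0 mul0r.
Qed.

HB.instance Definition _ := Lmodule_isNormed.Build R dual_space
  dual_norm_triangle dual_normZ dual_norm0_eq0.

Lemma dual_normE (f : dual_space) : `|f| = sup [set `|f x| | x in unit_ball X].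
Proof. by []. Qed.

Lemma dual_complete (F : set_system dual_space) : ProperFilter F -> cauchy F -> cvg F.
Proof.
move=> FF Fc; have /cauchyP Fc' := Fc.
pose ev (x : X) (f : dual_space) : R^o := f x.
have evc (x : X) : cvg (ev x @ F).
  apply: cauchy_cvg; apply: cauchy_exP => e e0.
  have d0 : 0 < e / (`|x| + 1) by rewrite divr_gt0// ltr_wpDl.
  have [g Fg] := Fc' _ d0; exists (g x); rewrite /fmap /=.
  apply: filterS Fg => f; rewrite -ball_normE /= => gf.
  rewrite -ball_normE /= /ev.
  apply: (le_lt_trans (le_dual_norm (g - f) x)).
  apply: (@le_lt_trans _ _ (e / (`|x| + 1) * `|x|)).
    by rewrite ler_wpM2r// ltW.
  by rewrite mulrAC ltr_pdivrMr ?ltr_wpDl// ltr_pM2l// ltrDl.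
pose l (x : X) : R^o := lim (ev x @ F).
have l_lin : linear l.
  move=> a x y; apply/cvg_lim => //.
  have -> : ev (a *: x + y) = (fun f => a *: ev x f + ev y f).
    by apply/funext => f; rewrite /ev linearP.
  by apply: cvgD; [apply: cvgZr; exact: evc | exact: evc].
have l_close (g : dual_space) (e : R) : F (ball g e) ->
    forall x, `|g x - l x| <= e * `|x|.
  move=> Fg x.
  have lc : (fun f : dual_space => `|g x - ev x f|) @ F --> `|g x - l x|.
    by apply: cvg_norm; apply: cvgB; [exact: cvg_cst | exact: evc].
  apply: (cvgr_to_le lc); apply: filterS Fg => f; rewrite -ball_normE /= => gf.
  apply: (le_trans (le_dual_norm (g - f) x)).
  by rewrite ler_wpM2r// ltW.
pose L : {linear X -> R^o} := HB.pack l (GRing.isLinear.Build _ _ _ _ _ l_lin).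
have l_cont : continuous l.
  have [g Fg] := Fc' 1 ltr01.
  apply: (@bounded_linear_continuous _ _ _ L); apply/linear_boundedP.
  exists (1 + `|g|); split; first exact: num_real.
  move=> r rg x; rewrite -[L x](subKr (g x : R^o)).
  apply: (le_trans (ler_normB _ _)).
  have := lerD (le_dual_norm g x) (l_close g 1 Fg x).
  move/le_trans; apply; rewrite -mulrDl ler_wpM2r// addrC.
  exact: ltW.
have l_mem : l \in @dual_pred R X by apply/dual_predP.
apply/cvg_ex; exists (DualSpace l_mem); apply/cvgrPdist_lt => e e0.
have e20 : 0 < e / 2 by rewrite divr_gt0.
have [g Fg] := Fc' _ e20; near=> f.
rewrite -(subrKA g) [e]splitr.
apply: (le_lt_trans (ler_normD _ _)); apply: ler_ltD; last first.
  have : ball g (e / 2) f by near: f.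
  by rewrite -ball_normE.
apply: dual_norm_le => x x1; rewrite distrC.
apply: (le_trans (l_close g _ Fg x)).
by rewrite ler_piMr// ltW.
Unshelve. all: by end_near. Qed.

HB.instance Definition _ := Uniform_isComplete.Build dual_space dual_complete.

End DualSpaceTheory.

Arguments dual_space {R} X.

Definition slice (R : realType) (X : normedModType R) (f : dual_space X) (e : R) :
  set X := [set x | unit_ball X x /\ 1 - e < f x].

(* edist_inf A y is the distance from y to A, valued in \bar R since it is +oo
   for empty A; a slice given by a norm-one functional is never empty. *)
Definition is_GL (R : realType) (X : completeNormedModType R) : Prop :=
  forall (x : X) (e : R), unit_sphere X x -> 0 < e ->
  exists f : dual_space X, [/\ unit_sphere (dual_space X) f,
    slice f e x &
    forall y : X, unit_sphere X y ->
      (edist_inf (slice f e) y + edist_inf [set (- z)%R | z in slice f e] y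
        < (2 + e)%:E)%E].

(* A map between the spheres is given by a function X -> Y of which only the
   values on the unit sphere matter. *)
Definition has_MUP (R : realType) (X : completeNormedModType R) : Prop :=
  forall (Y : completeNormedModType R) (T : X -> Y),
    set_bij (unit_sphere X) (unit_sphere Y) T ->
    (forall x y, unit_sphere X x -> unit_sphere X y ->
      `|T x - T y| = `|x - y|) ->
  exists U : {linear X -> Y},
    [/\ bijective U,
        forall x y, `|U x - U y| = `|x - y| &
        forall x, unit_sphere X x -> U x = T x].

(* Main.v *)
Require Import Defs.
From HB Require Import structures.
From mathcomp Require Import all_boot all_order all_algebra.
From mathcomp Require Import all_classical all_reals all_analysis.
From mathcomp Require Import lra.

(** Let [T] be an isometry of the unit sphere of [X] onto that of [Y].  Its
positively homogeneous extension [U] is a norm-preserving bijection, isometric on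
every sphere centred at 0.  Everything rests on the inequality
[|x - l *: y| <= |T x - l *: T y|] for unit vectors [x], [y] and [l >= 0],
which says that [U] does not contract distances.

This inequality follows from a purely metric property of [X]
([has_opposite_pairs]): there are unit vectors [u], [v] which are almost
opposite, [|u - v| ~ 2], with [|x - u| + l |y - v| <= 1 + l - |x - l *: y|] up
to a small error.  All the distances involved, except [|x - l *: y|], are
distances within the sphere, so [T] preserves them; and since
[|T u - T v| ~ 2] forces [|T u - l *: T v| ~ 1 + l], the triangle inequality
in [Y] gives back [|T x - l *: T y| >= |x - l *: y|].

In a GL-space the pair comes from the slice attached to the normalisation of
[x - l *: y], say of a functional [f].  At a unit vector [w] the GL-inequality
can only hold if the distances from [w] to the slice and to its opposite are
about [1 - f w] and [1 + f w].  Taking [u] in the slice near [x] and [v] in the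
opposite slice near [y], the sum of the distances becomes
[1 + l - f (x - l *: y)], while [f] separates [u] and [v] by almost 2.  If the
bidual is GL, this produces [u] and [v] in the bidual, and they must be moved
into [X].  Since some functional on [X] already separates them by almost 2, each
of them may be replaced by any vector of [X] in a slightly larger ball, almost
as close to [x] or [y], at which that functional takes almost the same value.
Such a vector is given by [two_ball_reflexivity], a Helly-type consequence of
the Hahn-Banach theorem, which is proved first.

Finally a bijection such as [U], which is norm-preserving, isometric on
spheres and does not contract distances, is an isometry
([noncontracting_isometry]): a segment can be prolonged until its endpoints
have the same norm, and distances add up along it.  A bijective isometry
preserves midpoints ([bij_isometry_midpoint], the Mazur-Ulam theorem), so the
positively homogeneous [U] is linear. *)

Set Implicit Arguments.
Unset Strict Implicit.
Unset Printing Implicit Defensive.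

Import Order.TTheory GRing.Theory Num.Theory.
Import numFieldNormedType.Exports.

Local Open Scope classical_set_scope.
Local Open Scope ring_scope.

(** * Sublinear functionals and the Hahn-Banach theorem *)

Definition sublinear (R : realType) (V : lmodType R) (p : V -> R) : Prop :=
  (forall x y, p (x + y) <= p x + p y) /\
  (forall t x, 0 <= t -> p (t *: x) <= t * p x).

Lemma sublinear0 (R : realType) (V : lmodType R) (p : V -> R) :
  sublinear p -> p 0 = 0.
Proof.
move=> [pD pZ]; apply/eqP; rewrite eq_le; apply/andP; split.
  by have := pZ 0 0 (lexx 0); rewrite scale0r mul0r.
by have := pD 0 0; rewrite addr0; lra.
Qed.

Lemma sublinearN (R : realType) (V : lmodType R) (p : V -> R) x :
  sublinear p -> - p (- x) <= p x.
Proof.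
move=> sp; have := sublinear0 sp; have := sp.1 x (- x); rewrite subrr; lra.
Qed.

Lemma sublinearZ (R : realType) (V : lmodType R) (p : V -> R) t x :
  sublinear p -> 0 <= t -> p (t *: x) = t * p x.
Proof.
move=> sp; rewrite le_eqVlt => /predU1P[<-|t0].
  by rewrite scale0r mul0r sublinear0.
apply/eqP; rewrite eq_le; apply/andP; split; first by rewrite sp.2 // ltW.
rewrite -ler_pdivlMl// -{1}[x](scalerK (lt0r_neq0 t0)).
by rewrite sp.2 // invr_ge0 ltW.
Qed.

(** The largest sublinear functional [q] below [p] with [q (- y) <= - p y].  It
coincides with [p] only if [p (- y) = - p y], so a minimal sublinear functional
is odd, hence linear; it also serves to prescribe the value at [y]. *)
Definition tilt (R : realType) (V : lmodType R) (p : V -> R) (y x : V) : R :=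
  inf [set p (x + t *: y) - t * p y | t in [set t | 0 <= t]].

Lemma le_tilt (R : realType) (V : lmodType R) (p : V -> R) (y x : V) t :
  sublinear p -> 0 <= t -> tilt p y x <= p (x + t *: y) - t * p y.
Proof.
move=> sp t0; apply: ge_inf; last by exists t.
exists (- p (- x)) => _ [s s0 <-].
rewrite -(sublinearZ y sp s0).
have := sp.1 (x + s *: y) (- x).
by rewrite addrAC subrr add0r; lra.
Qed.

Lemma tilt_le (R : realType) (V : lmodType R) (p : V -> R) (y x : V) :
  sublinear p -> tilt p y x <= p x.
Proof.
by move=> sp; have := le_tilt y x sp (lexx 0); rewrite scale0r mul0r addr0 subr0.
Qed.

Lemma tiltN (R : realType) (V : lmodType R) (p : V -> R) (y : V) :
  sublinear p -> tilt p y (- y) <= - p y.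
Proof.
move=> sp; have := le_tilt y (- y) sp ler01.
by rewrite scale1r addNr sublinear0// mul1r add0r.
Qed.

Lemma tilt_glb (R : realType) (V : lmodType R) (p : V -> R) (y x : V) c :
  (forall t, 0 <= t -> c <= p (x + t *: y) - t * p y) -> c <= tilt p y x.
Proof.
move=> h; apply: lb_le_inf; first by exists (p (x + 0 *: y) - 0 * p y), 0 => //=.
by move=> _ [t t0 <-]; apply: h.
Qed.

Lemma sublinear_tilt (R : realType) (V : lmodType R) (p : V -> R) (y : V) :
  sublinear p -> sublinear (tilt p y).
Proof.
move=> sp; split=> [x z|s x].
  rewrite -lerBlDr; apply: tilt_glb => t t0; rewrite lerBlDr -lerBlDl.
  apply: tilt_glb => s s0; rewrite lerBlDl.
  apply: (le_trans (le_tilt y (x + z) sp (addr_ge0 t0 s0))).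
  have := sp.1 (x + t *: y) (z + s *: y).
  by rewrite addrACA -scalerDl mulrDl; lra.
rewrite le_eqVlt => /predU1P[<-|s0].
  by rewrite scale0r mul0r (le_trans (tilt_le y 0 sp))// sublinear0.
rewrite -ler_pdivrMl//; apply: tilt_glb => t t0; rewrite ler_pdivrMl//.
apply: (le_trans (le_tilt y (s *: x) sp (mulr_ge0 (ltW s0) t0))).
by rewrite -scalerA -scalerDr mulrBr mulrA lerD2r sp.2 // ltW.
Qed.

(** Zorn's lemma applies because the pointwise infimum of a chain of sublinear
functionals below [p] is sublinear, and it is finite because each member is
bounded below by [- p (- x)] at [x]. *)
Lemma minimal_sublinear (R : realType) (V : lmodType R) (p : V -> R) :
  sublinear p ->
  exists q : V -> R, [/\ sublinear q, forall x, q x <= p x &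
    forall q', sublinear q' -> (forall x, q' x <= q x) -> q' = q].
Proof.
move=> sp.
pose T := {q : V -> R | sublinear q /\ forall x, q x <= p x}.
pose below (q q' : T) := `[< forall x, sval q' x <= sval q x >].
have [||||[q [sq qp]] qmin] := @Zorn T below.
- by move=> q; apply/asboolP.
- move=> q r s /asboolP qr /asboolP rs; apply/asboolP => x.
  exact: le_trans (rs x) (qr x).
- move=> [q hq] [r hr] /asboolP /= qr /asboolP /= rq; apply: eq_exist.
  by apply/funext => x; apply/eqP; rewrite eq_le qr rq.
- move=> A Atot; have [[a Aa]|A0] := pselect (exists a, A a); last first.
    by exists (exist _ p (conj sp (fun x => lexx _))) => s As; case: A0; exists s.
  pose m x := inf [set sval q x | q in A].
  have m_lb x (q : T) : A q -> m x <= sval q x.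
    move=> Aq; apply: ge_inf; last by exists q.
    exists (- p (- x)) => _ [[r [sr rp]] Ar <-] /=.
    by apply: le_trans (sublinearN x sr); rewrite lerN2.
  have m_glb x c : (forall q, A q -> c <= sval q x) -> c <= m x.
    move=> h; apply: lb_le_inf; first by exists (sval a x), a.
    by move=> _ [q Aq <-]; apply: h.
  (* Subadditivity compares values of two members of the chain, hence uses
     that the smaller of the two bounds both of them. *)
  have sm : sublinear m.
    split=> [x y|t x].
      rewrite -lerBlDr; apply: (m_glb) => q Aq; rewrite lerBlDr -lerBlDl.
      apply: (m_glb) => r Ar; rewrite lerBlDl.
      have [/asboolP h|/asboolP h] := Atot _ _ Aq Ar.
      + apply: le_trans (m_lb _ _ Ar) _; apply: le_trans ((svalP r).1.1 _ _) _.
        by rewrite lerD2r.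
      + apply: le_trans (m_lb _ _ Aq) _; apply: le_trans ((svalP q).1.1 _ _) _.
        by rewrite lerD2l.
    rewrite le_eqVlt => /predU1P[<-|t0].
      rewrite scale0r mul0r; apply: le_trans (m_lb _ _ Aa) _.
      by rewrite (sublinear0 (svalP a).1).
    rewrite -ler_pdivrMl//; apply: (m_glb) => q Aq; rewrite ler_pdivrMl//.
    by apply: le_trans (m_lb _ _ Aq) _; apply: (svalP q).1.2; apply: ltW.
  have mp x : m x <= p x := le_trans (m_lb x a Aa) ((svalP a).2 x).
  by exists (exist _ m (conj sm mp)) => q Aq; apply/asboolP => x /=; apply: m_lb.
exists q; split=> // r sr rq.
have rp x : r x <= p x := le_trans (rq x) (qp x).
by have /(congr1 sval) := qmin (exist _ r (conj sr rp)) (asboolT rq).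
Qed.

(** A linear functional below [tilt p z] takes at [- z] a value at most
[- p z], hence at [z] a value at least [p z]. *)
Lemma hahn_banach (R : realType) (V : lmodType R) (p : V -> R) (z : V) :
  sublinear p ->
  exists F : {linear V -> R^o}, (forall x, F x <= p x) /\ F z = p z.
Proof.
move=> sp; have [q [sq qp qmin]] := minimal_sublinear (sublinear_tilt z sp).
have qN x : q (- x) = - q x.
  apply/eqP; rewrite eq_le; apply/andP; split; last first.
    by have := sublinearN x sq; lra.
  have qx := qmin _ (sublinear_tilt x sq) (fun w => tilt_le x w sq).
  by have := tiltN x sq; rewrite qx.
have qD x y : q (x + y) = q x + q y.
  apply/eqP; rewrite eq_le sq.1 /=.
  by have := sq.1 (x + y) (- y); rewrite addrK qN; lra.
have qZ a x : q (a *: x) = a * q x.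
  have [a0|a0] := leP 0 a; first exact: sublinearZ.
  by rewrite -[a]opprK scaleNr qN mulNr sublinearZ// oppr_ge0 ltW.
have qlin : linear (q : V -> R^o) by move=> a x y; rewrite qD qZ.
pose Q : {linear V -> R^o} := HB.pack q (GRing.isLinear.Build _ _ _ _ _ qlin).
exists Q; split.
- by move=> x; apply: le_trans (qp x) (tilt_le _ _ sp).
- apply/eqP; rewrite eq_le (le_trans (qp z) (tilt_le _ _ sp))/=.
  by have := le_trans (qp (- z)) (tiltN z sp); rewrite qN lerN2.
Qed.

(** * The canonical embedding into the bidual *)

Lemma bounded_dual (R : realType) (X : normedModType R) (F : X -> R^o) (C : R) :
  linear F -> (forall x, F x <= C * `|x|) ->
  exists g : dual_space X, forall x, g x = F x.
Proof.
move=> Flin FC.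
pose L : {linear X -> R^o} := HB.pack F (GRing.isLinear.Build _ _ _ _ _ Flin).
have Lbound x : `|L x| <= C * `|x|.
  by rewrite ler_norml FC andbT lerNl -[X in X <= _](linearN L) -[`|x|]normrN FC.
have Lc : continuous L.
  apply: bounded_linear_continuous; apply/linear_boundedP.
  exists C; split; first exact: num_real.
  move=> r Cr x; apply: le_trans (Lbound x) _.
  by rewrite ler_wpM2r// ltW.
have LP : F \in @dual_pred R X by apply/dual_predP.
by exists (DualSpace LP).
Qed.

Lemma sublinear_norm (R : realType) (X : normedModType R) :
  sublinear (fun x : X => `|x|).
Proof.
split; first exact: ler_normD.
by move=> t x t0; rewrite normrZ ger0_norm.
Qed.

Lemma norming_functional (R : realType) (X : normedModType R) (x : X) :
  exists g : dual_space X, `|g| <= 1 /\ g x = `|x|.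
Proof.
have [F [FN Fx]] := hahn_banach x (sublinear_norm X).
have [|g gF] := @bounded_dual R X F 1 (linearP F).
  by move=> y; rewrite mul1r.
exists g; split; last by rewrite gF.
apply: dual_norm_le => y y1; rewrite ler_norml.
have gN w : g w <= `|w| by rewrite gF.
rewrite (le_trans (gN y))// andbT lerNl -[X in X <= _](linearN g).
by rewrite (le_trans (gN _))// normrN.
Qed.

Lemma evaluation_exists (R : realType) (X : normedModType R) (x : X) :
  exists J : dual_space (dual_space X), forall f, J f = f x.
Proof.
apply: (@bounded_dual R (dual_space X) (fun f => f x) `|x|) => // f.
by rewrite mulrC; apply: le_trans (ler_norm _) (le_dual_norm f x).
Qed.

Definition bidual_emb (R : realType) (X : normedModType R) (x : X) :
  dual_space (dual_space X) := projT1 (cid (evaluation_exists x)).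

Lemma bidual_embE (R : realType) (X : normedModType R) (x : X) (f : dual_space X) :
  bidual_emb x f = f x.
Proof. exact: (projT2 (cid (evaluation_exists x))). Qed.

Lemma bidual_embP (R : realType) (X : normedModType R) a (x y : X) :
  bidual_emb (a *: x + y) = a *: bidual_emb x + bidual_emb y.
Proof.
apply: dualP => f.
have -> : (a *: bidual_emb x + bidual_emb y) f =
  a *: bidual_emb x f + bidual_emb y f by [].
by rewrite !bidual_embE linearP.
Qed.

Lemma norm_bidual_emb (R : realType) (X : normedModType R) (x : X) :
  `|bidual_emb x| = `|x|.
Proof.
apply/eqP; rewrite eq_le; apply/andP; split.
  apply: dual_norm_le => f f1; rewrite bidual_embE.
  by apply: le_trans (le_dual_norm f x) _; rewrite ler_piMl.
have [g [g1 gx]] := norming_functional x.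
by have := dual_norm_ub (bidual_emb x) g1; rewrite bidual_embE gx normr_id.
Qed.

(** * Local reflexivity for two balls *)

(** The hypothesis says that [z] is at [N]-distance at least 1 from the range of
[L].  That distance is a sublinear function of [z] which vanishes on the range,
and [F] is a functional below it that attains it at [z]. *)
Lemma separating_functional (R : realType) (X W : lmodType R)
    (N : W -> R) (L : {linear X -> W}) (z : W) :
  sublinear N -> (forall w, 0 <= N w) ->
  (forall u, 1 <= N (z - L u)) ->
  exists F : {linear W -> R^o}, [/\ forall w, F w <= N w,
    forall u, F (L u) = 0 & 1 <= F z].
Proof.
move=> sN N0 far.
pose dist w := inf [set N (w - L u) | u in setT].
have dist_lb w u : dist w <= N (w - L u).
  apply: ge_inf; last by exists u.
  by exists 0 => _ [v _ <-].
have dist_glb w c : (forall u, c <= N (w - L u)) -> c <= dist w.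
  move=> h; apply: lb_le_inf; first by exists (N (w - L 0)), 0.
  by move=> _ [u _ <-].
have sdist : sublinear dist.
  split=> [w w'|t w].
    rewrite -lerBlDr; apply: (dist_glb) => u; rewrite lerBlDr -lerBlDl.
    apply: (dist_glb) => v; rewrite lerBlDl.
    apply: le_trans (dist_lb _ (u + v)) _.
    by rewrite linearD opprD addrACA sN.1.
  rewrite le_eqVlt => /predU1P[<-|t0].
    rewrite scale0r mul0r; apply: le_trans (dist_lb _ 0) _.
    by rewrite linear0 subrr sublinear0.
  rewrite -ler_pdivrMl//; apply: (dist_glb) => u; rewrite ler_pdivrMl//.
  apply: le_trans (dist_lb _ (t *: u)) _.
  by rewrite linearZ/= -scalerBr sN.2// ltW.
have [F [Fdist Fz]] := hahn_banach z sdist.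
have FL u : F (L u) <= 0.
  by apply: le_trans (Fdist _) (le_trans (dist_lb _ u) _); rewrite subrr sublinear0.
exists F; split=> //.
- by move=> w; apply: le_trans (Fdist _) (le_trans (dist_lb _ 0) _);
    rewrite linear0 subr0.
- move=> u; apply/eqP; rewrite eq_le FL/=.
  by have := FL (- u); rewrite linearN linearN/= oppr_le0.
- by rewrite Fz; apply: (dist_glb).
Qed.

Lemma sublinear_max (R : realType) (V : lmodType R) (p q : V -> R) :
  sublinear p -> sublinear q -> sublinear (fun x => Num.max (p x) (q x)).
Proof.
move=> sp sq; split=> [x y|t x t0]; rewrite ge_max; apply/andP; split.
- by apply: le_trans (sp.1 x y) _; rewrite lerD// le_max lexx.
- by apply: le_trans (sq.1 x y) _; rewrite lerD// le_max lexx orbT.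
- by apply: le_trans (sp.2 t x t0) _; rewrite ler_wpM2l// le_max lexx.
- by apply: le_trans (sq.2 t x t0) _; rewrite ler_wpM2l// le_max lexx orbT.
Qed.

Lemma sublinear_scaled_norm (R : realType) (V : lmodType R)
    (X : normedModType R) (P : V -> X) (c : R) :
  linear P -> 0 <= c -> sublinear (fun x => `|P x| / c).
Proof.
move=> Plin c0.
pose PP : {linear V -> X} := HB.pack P (GRing.isLinear.Build _ _ _ _ _ Plin).
have ic0 : 0 <= c^-1 by rewrite invr_ge0.
split=> [x y|t x t0].
  by rewrite [P _](linearD PP) -mulrDl ler_wpM2r// ler_normD.
by rewrite [P _](linearZ_LR PP) normrZ ger0_norm// mulrA.
Qed.

Lemma dual_attain (R : realType) (X : normedModType R) (g : dual_space X) (x : X) :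
  exists2 y, `|y| = `|x| & g y = `|g x|.
Proof.
have [h|h] := ler0P (g x); last by exists x.
by exists (- x); rewrite ?normrN// linearN.
Qed.

Lemma dual_norm2_le (R : realType) (X : normedModType R) (g h : dual_space X) (a b : R) :
  0 < a -> 0 < b ->
  (forall x y, `|x| <= 1 -> `|y| <= 1 -> a * g x + b * h y <= 1) ->
  a * `|g| + b * `|h| <= 1.
Proof.
move=> a0 b0 gh.
rewrite -lerBrDl -ler_pdivlMl//; apply: dual_norm_le => y y1.
rewrite ler_pdivlMl// lerBrDl -lerBrDr -ler_pdivlMl//.
apply: dual_norm_le => x x1; rewrite ler_pdivlMl// lerBrDr.
have [x' x'x <-] := dual_attain g x; have [y' y'y <-] := dual_attain h y.
by apply: gh; rewrite ?x'x ?y'y.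
Qed.

(** If no such [u] exists, then [(0, x, U f)] is at distance at least 1 from
the subspace of all [(u, u, f u)], for the maximum norm with radii [1 + e],
[a + e] and [e].  A separating functional splits as [(g, h, k)], with
[(1 + e) |g| + (a + e) |h| <= 1] since it is below the norm, and with
[g + h + k f = 0] since it vanishes on the subspace.  Applying [U] to the last
identity, [h x + k (U f)] becomes [(bidual_emb x - U) h - U g], which is at most
[a |h| + |g|].  As this has to be at least 1, both [g] and [h] vanish, a
contradiction. *)
Lemma two_ball_reflexivity (R : realType) (X : normedModType R)
    (U : dual_space (dual_space X)) (x : X) (f : dual_space X) (a e : R) :
  `|U| <= 1 -> `|bidual_emb x - U| <= a -> 0 < e ->
  exists u : X, [/\ `|u| < 1 + e, `|x - u| < a + e & `|U f - f u| < e].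
Proof.
move=> U1 xU e0; apply: contrapT => none.
have a0 : 0 <= a by apply: le_trans xU.
have e1 : 0 < 1 + e by rewrite addr_gt0.
have ae : 0 < a + e by rewrite ltr_wpDl.
pose W : lmodType R := (X * X * R^o)%type.
pose N (w : W) := Num.max (`|w.1.1| / (1 + e))
  (Num.max (`|w.1.2| / (a + e)) (`|w.2| / e)).
pose L (u : X) : W := (u, u, f u).
pose z : W := (0, x, U f).
have Llin : linear L by move=> t u v; rewrite /L linearP.
pose LL : {linear X -> W} := HB.pack L (GRing.isLinear.Build _ _ _ _ _ Llin).
have sN : sublinear N.
  by apply: sublinear_max; [|apply: sublinear_max];
    apply: sublinear_scaled_norm => //; apply: ltW.
have [||F [FN FL Fz]] := @separating_functional R X W N LL z sN.
- by move=> w; rewrite /N le_max divr_ge0// ltW.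
- move=> u; rewrite leNgt; apply/negP; rewrite /N !gt_max => /and3P[h1 h2 h3].
  apply: none; exists u; move: h1 h2 h3; rewrite !ltr_pdivrMr// !mul1r /=.
  by rewrite sub0r normrN.
have [g gF] : exists g : dual_space X, forall v, g v = F (v, 0, 0).
  apply: (@bounded_dual _ _ (fun v => F (v, 0, 0)) (1 + e)^-1).
    by move=> t v w; rewrite -linearP; congr (F _); congr (_, _, _); rewrite /= scaler0 addr0.
  move=> v; apply: le_trans (FN _) _; rewrite /N /= !normr0 !mul0r maxxx max_l//.
    by rewrite mulrC.
  by rewrite divr_ge0// ltW.
have [h hF] : exists h : dual_space X, forall v, h v = F (0, v, 0).
  apply: (@bounded_dual _ _ (fun v => F (0, v, 0)) (a + e)^-1).
    by move=> t v w; rewrite -linearP; congr (F _); congr (_, _, _); rewrite /= scaler0 addr0.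
  move=> v; apply: le_trans (FN _) _; rewrite /N /= !normr0 !mul0r.
  by rewrite max_r ?le_max ?lexx ?orbT// max_l mulrC// mulr_ge0// invr_ge0 ltW.
pose k : R := F (0, 0, 1).
have FE v w c : F (v, w, c) = g v + h w + c * k.
  rewrite gF hF /k -[c * _]linearZ -!linearD /=.
  by congr (F _); congr (_, _, _); rewrite /= ?scaler0 ?addr0 ?add0r//; rewrite /GRing.scale/= mulr1.
have ghk : k *: f = - g - h.
  apply: dualP => v.
  have -> : (k *: f) v = k * f v by [].
  have -> : (- g - h) v = - g v - h v by [].
  have := FL v; rewrite FE; lra.
have gh1 : (1 + e) * `|g| + (a + e) * `|h| <= 1.
  apply: dual_norm2_le => // v w v1 w1.
  have -> : (1 + e) * g v + (a + e) * h w = F ((1 + e) *: v, (a + e) *: w, 0).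
    by rewrite FE mul0r addr0 !linearZ.
  apply: le_trans (FN _) _; rewrite /N /= !normrZ normr0 mul0r !ge_max ler01 andbT.
  rewrite !gtr0_norm// ![_ * `|_| / _]mulrAC !divff ?gt_eqF// !mul1r.
  by rewrite v1 w1.
have Fz_le : F z <= `|g| + a * `|h|.
  have -> : F z = (bidual_emb x - U) h - U g.
    have -> : (bidual_emb x - U) h = h x - U h by rewrite -(bidual_embE x h).
    have : U (k *: f) = - U g - U h by rewrite ghk linearB linearN.
    rewrite linearZ /z FE linear0 => kU.
    have -> : U f * k = - U g - U h by rewrite -kU mulrC.
    by lra.
  have h1 : (bidual_emb x - U) h <= a * `|h|.
    apply: le_trans (ler_norm _) (le_trans (le_dual_norm _ h) _).
    by rewrite ler_wpM2r.
  have h2 : - U g <= `|g|.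
    rewrite -linearN; apply: le_trans (ler_norm _) (le_trans (le_dual_norm _ _) _).
    by rewrite normrN ler_piMl.
  by lra.
have : e * (`|g| + `|h|) <= 0 by lra.
rewrite pmulr_rle0// => gh0.
have g0 : `|g| = 0 by have := normr_ge0 g; have := normr_ge0 h; lra.
have h0 : `|h| = 0 by have := normr_ge0 g; have := normr_ge0 h; lra.
by move: Fz Fz_le; rewrite g0 h0; lra.
Qed.

(** * Opposite pairs from slices of the bidual *)

Lemma edist_inf_lt (R : realType) (X : normedModType R) (A : set X) (y : X) (r : R) :
  (edist_inf A y < r%:E)%E -> exists2 z, A z & `|y - z| < r.
Proof.
move=> /ereal_inf_lt[_ [z Az <-]] /edist_lt_ball yz; exists z => //.
by move: yz; rewrite -ball_normE.
Qed.

Lemma edist_inf_sum_lt (R : realType) (X : normedModType R) (A B : set X) (y : X) (r : R) :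
  (edist_inf A y + edist_inf B y < r%:E)%E ->
  exists u v, [/\ A u, B v & `|y - u| + `|y - v| < r].
Proof.
have := edist_inf_ge0 A y; have := edist_inf_ge0 B y.
case dA : (edist_inf A y) => [a| |]//; case dB : (edist_inf B y) => [b| |]//.
rewrite !lee_fin -EFinD lte_fin => b0 a0 abr.
pose s := (r - (a + b)) / 2.
have [|u Au yu] := @edist_inf_lt _ _ A y (a + s).
  by rewrite dA lte_fin /s; lra.
have [|v Bv yv] := @edist_inf_lt _ _ B y (b + s).
  by rewrite dB lte_fin /s; lra.
by exists u, v; split=> //; move: yu yv; rewrite /s; lra.
Qed.

Lemma dual_norm_approx (R : realType) (X : normedModType R) (g : dual_space X) (c : R) :
  c < `|g| -> exists2 x, `|x| <= 1 & c < g x.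
Proof.
move=> /(sup_gt (proj1 (dual_has_sup g)))[_ [x x1 <-] cx].
by have [y yx gy] := dual_attain g x; exists y; rewrite ?yx ?gy.
Qed.

Lemma normalize (R : realType) (X : normedModType R) (u : X) (d : R) :
  d < 1 -> 1 - d < `|u| < 1 + d ->
  exists2 u' : X, `|u'| = 1 & `|u - u'| <= d.
Proof.
move=> d1 /andP[du ud]; have u0 : 0 < `|u| by lra.
exists (`|u|^-1 *: u).
  by rewrite normrZ gtr0_norm ?invr_gt0// mulVf ?gt_eqF.
rewrite -{1}[u]scale1r -scalerBl normrZ -{2}[`|u|]gtr0_norm// -normrM mulrBl.
by rewrite mul1r mulVf ?gt_eqF// ler_norml; lra.
Qed.

(** For a functional [f] that norms [x - l *: y], the bound reads
[|x - u| + l |y - v| <= (1 - f x) + l (1 + f y)] up to [e]: as if [u] and [v]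
were points nearest to [x] and [y] in opposite faces of the ball. *)
Definition has_opposite_pairs (R : realType) (X : normedModType R) : Prop :=
  forall (x y : X) (l e : R), `|x| = 1 -> `|y| = 1 -> 0 <= l -> x != l *: y -> 0 < e ->
  exists u v : X, [/\ `|u| = 1, `|v| = 1, 2 - e <= `|u - v| &
    `|x - u| + l * `|y - v| <= 1 + l - `|x - l *: y| + e].

(** As [f] has norm 1, [1 - e - f y < |y - u|] and [1 - e + f y < |y + v|] for
all [u], [v] in the slice.  The lower bounds add up to [2 - 2 e], so when the
sum of the distances is less than [2 + e], neither can exceed its lower bound
by much. *)
Lemma GL_slice_points (R : realType) (X : completeNormedModType R) (z : X) (e : R) :
  is_GL X -> `|z| = 1 -> 0 < e ->
  exists f : dual_space X, [/\ `|f| = 1, 1 - e < f z &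
    forall y, `|y| = 1 -> exists u v : X,
     [/\ `|u| <= 1, `|v| <= 1, 1 - e < f u & 1 - e < f v] /\
     [/\ `|y - u| < 1 - f y + 2 * e & `|y + v| < 1 + f y + 2 * e]].
Proof.
move=> GL z1 e0; have [f [f1 [_ fz] fy]] := GL z e z1 e0.
exists f; split=> // y y1.
have [u [_ [[u1 fu] [v [v1 fv] <-] yuv]]] := edist_inf_sum_lt (fy y y1).
exists u, v; split=> //; rewrite opprK in yuv.
have fle w : f w <= `|w|.
  by apply: le_trans (ler_norm _) (le_trans (le_dual_norm f w) _); rewrite [dual_norm f]f1 mul1r.
have := fle (u - y); have := fle (y + v).
rewrite linearB linearD [`|u - y|]distrC /= => h1 h2; split; lra.
Qed.

(** The slice is the one attached to [J (x - l *: y)], normalised.  [U] and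
[- V] are the almost nearest points to [J x] and [J y] in it and in its
opposite, and [f] is a functional on [X] at which both [U] and [V] are almost 1.
The vectors [u], [v] that approximate them in [X] almost have norm 1, because
[f u] and [- f v] are almost 1, so that they can be normalised. *)
Lemma bidual_GL_opposite_pairs (R : realType) (X : normedModType R) :
  is_GL (dual_space (dual_space X)) -> has_opposite_pairs X.
Proof.
move=> GL x y l e x1 y1 l0 xy e0.
set n := `|x - l *: y|.
have n0 : 0 < n by rewrite normr_gt0 subr_eq0.
have nl : n <= 1 + l.
  by rewrite /n; apply: le_trans (ler_normB _ _) _; rewrite normrZ x1 y1 mulr1 ger0_norm.
(* The losses accumulated below are at most [12 * (1 + l) * d]; the bound by 1
   ensures that the vectors to be normalised are nonzero. *)
pose d := Num.min e 1 / (12 * (1 + l)).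
have m0 : 0 < Num.min e 1 by rewrite lt_min e0 ltr01.
have l1 : 0 < 12 * (1 + l) by lra.
have d0 : 0 < d by rewrite divr_gt0.
have dl : 12 * d + 12 * (d * l) = Num.min e 1.
  by rewrite -[RHS](@divfK _ (12 * (1 + l))) ?gt_eqF// -/d; lra.
have dl0 : 0 <= d * l by rewrite mulr_ge0// ltW.
have de : 12 * d + 12 * (d * l) <= e by rewrite dl ge_min lexx.
have d1 : 12 * d + 12 * (d * l) <= 1 by rewrite dl ge_min lexx orbT.
pose J := @bidual_emb R X.
have Jlin : J (x - l *: y) = J x - l *: J y.
  by rewrite /J addrC -scaleNr bidual_embP scaleNr addrC.
have [||z [z1 zz zP]] := @GL_slice_points R _ (n^-1 *: J (x - l *: y)) d GL.
- by rewrite normrZ norm_bidual_emb -/n gtr0_norm ?invr_gt0// mulVf// gt_eqF.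
- by [].
have zxy : n - (d + d * l) <= z (J x) - l * z (J y).
  have -> : z (J x) - l * z (J y) = n * z (n^-1 *: J (x - l *: y)).
    have -> : z (J x) - l * z (J y) = z (J (x - l *: y)).
      by rewrite Jlin linearB; congr (_ - _); rewrite (linearZ_LR z).
    rewrite [z (n^-1 *: _)]linearZ /=.
    by rewrite [n * _]mulrA divff ?gt_eqF// mul1r.
  have h1 : n * (1 - d) <= n * z (n^-1 *: J (x - l *: y)) by rewrite ler_wpM2l// ltW.
  have h2 : n * d <= (1 + l) * d by rewrite ler_wpM2r// ltW.
  lra.
have Jx1 : `|J x| = 1 by rewrite norm_bidual_emb.
have Jy1 : `|J y| = 1 by rewrite norm_bidual_emb.
have [U [_ [[U1 _ zU _] [xU _]]]] := zP _ Jx1.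
have [_ [V [[_ V1 _ zV] [_ yV]]]] := zP _ Jy1.
have [f f1 UVf] : exists2 f : dual_space X, `|f| <= 1 & 2 - 2 * d < (U + V) f.
  apply: dual_norm_approx; have := le_dual_norm z (U + V).
  rewrite [dual_norm z]z1 mul1r linearD => h.
  have := le_trans (ler_norm _) h; lra.
have UVE : (U + V) f = U f + V f by [].
have le1 (W : dual_space (dual_space X)) : `|W| <= 1 -> W f <= 1.
  move=> W1; apply: le_trans (ler_norm _) (le_trans (dual_norm_ub _ f1) W1).
have Uf := le1 _ U1; have Vf := le1 _ V1.
have [u [u1 xu Ufu]] := two_ball_reflexivity f U1 (ltW xU) d0.
have [|||v [v1 yv Vfv]] := @two_ball_reflexivity _ _ (- V) y f (1 + z (J y) + 2 * d) d.
- by rewrite normrN.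
- by rewrite opprK ltW.
- by [].
have NVE : (- V) f = - V f by [].
move: Ufu Vfv; rewrite NVE !ltr_norml => /andP[Ufu1 Ufu2] /andP[Vfv1 Vfv2].
have fle w : `|f w| <= `|w|.
  by apply: le_trans (le_dual_norm f w) _; rewrite ler_piMl.
have fu := le_trans (ler_norm _) (fle u).
have fv := le_trans (ler_norm _) (fle (- v)).
have fuv := le_trans (ler_norm _) (fle (u - v)).
rewrite normrN linearN in fv; rewrite linearB in fuv.
have [||u' u'1 uu'] := @normalize _ _ u (3 * d); [lra|apply/andP; split; lra|].
have [||v' v'1 vv'] := @normalize _ _ v (3 * d); [lra|apply/andP; split; lra|].
exists u', v'; split=> //.
  have := ler_normD (u' - v') ((u - u') - (v - v')).
  have := ler_normB (u - u') (v - v').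
  have -> : u' - v' + (u - u' - (v - v')) = u - v.
    by rewrite opprB addrACA [u' + _]addrC subrK addKr.
  lra.
have xu' : `|x - u'| <= 1 - z (J x) + 6 * d.
  have := ler_normD (x - u) (u - u'); rewrite addrA addrNK; lra.
have yv' : l * `|y - v'| <= l * (1 + z (J y) + 6 * d).
  apply: ler_wpM2l => //.
  have := ler_normD (y - v) (v - v'); rewrite addrA addrNK; lra.
lra.
Qed.

(** * The Mazur-Ulam theorem *)

(** Composing [f] with the point reflection about the midpoint of [f x] and
[f y], then with the inverse [g] and the point reflection about the midpoint [m]
of [x] and [y], gives a bijective isometry [flip] that fixes [x] and [y] and
displaces [m] by twice the defect of [f].  The defect of every isometry is at
most [|x - y|], so iterating bounds [2 ^+ n] times the defect of [f]. *)
Lemma bij_isometry_defect (R : realType) (X : normedModType R) (x y : X) (n : nat) :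
  forall (Y : normedModType R) (f : X -> Y) (g : Y -> X),
  cancel f g -> cancel g f -> (forall a b, `|f a - f b| = `|a - b|) ->
  2 ^+ n * `|f (2^-1 *: (x + y)) - 2^-1 *: (f x + f y)| <= `|x - y|.
Proof.
set m := 2^-1 *: (x + y).
have half (Z : normedModType R) (z : Z) : 2^-1 *: (z + z) = z.
  by rewrite -mulr2n -[z *+ 2]scaler_nat scalerA mulVf ?scale1r// pnatr_eq0.
have xm : `|m - x| = 2^-1 * `|x - y|.
  have -> : m - x = 2^-1 *: (y - x).
    by rewrite /m -{2}(half X x) -scalerBr opprD addrACA subrr add0r.
  by rewrite normrZ gtr0_norm ?invr_gt0// distrC.
have ym : `|m - y| = 2^-1 * `|x - y|.
  have -> : m - y = 2^-1 *: (x - y).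
    by rewrite /m -{2}(half X y) -scalerBr opprD addrA addrK.
  by rewrite normrZ gtr0_norm ?invr_gt0.
elim: n => [|n IHn] Y f g fK gK fiso.
  rewrite expr0 mul1r.
  have -> : f m - 2^-1 *: (f x + f y) = 2^-1 *: ((f m - f x) + (f m - f y)).
    by rewrite addrACA -opprD scalerBr half.
  rewrite normrZ gtr0_norm ?invr_gt0//.
  have := ler_normD (f m - f x) (f m - f y); rewrite !fiso xm ym.
  have := normr_ge0 (x - y); lra.
have giso a b : `|g a - g b| = `|a - b| by rewrite -[in RHS](gK a) -[in RHS](gK b) fiso.
pose flip (w : X) : X := x + y - g (f x + f y - f w).
pose unflip (w : X) : X := g (f x + f y - f (x + y - w)).
have flipK : cancel flip unflip.
  by move=> w; rewrite /flip /unflip subKr gK subKr fK.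
have unflipK : cancel unflip flip.
  by move=> w; rewrite /flip /unflip gK subKr fK subKr.
have flipiso a b : `|flip a - flip b| = `|a - b|.
  by rewrite /flip opprB addrC addrA subrK giso opprB addrC addrA subrK fiso.
have flipx : flip x = x by rewrite /flip [f x + _]addrC addrK fK addrK.
have flipy : flip y = y by rewrite /flip addrK fK [x + _]addrC addrK.
have := IHn X flip unflip flipK unflipK flipiso.
rewrite flipx flipy -/m; suff -> : `|flip m - m| = 2 * `|f m - 2^-1 *: (f x + f y)|.
  by rewrite mulrA -exprSr.
have mm : x + y = m + m by rewrite /m -scalerDr half.
have -> : flip m - m = m - g (f x + f y - f m).
  by rewrite /flip mm addrAC addrK.
have -> : m - g (f x + f y - f m) = g (f m) - g (f x + f y - f m) by rewrite fK.
have -> : 2 * `|f m - 2^-1 *: (f x + f y)| = `|2 *: (f m - 2^-1 *: (f x + f y))|.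
  by rewrite normrZ gtr0_norm.
rewrite giso opprB addrA scalerBr scalerA divff ?pnatr_eq0// scale1r.
by rewrite scaler_nat mulr2n.
Qed.

(** The defect at the midpoint is 0, because its multiples by all powers of 2
are bounded. *)
Lemma bij_isometry_midpoint (R : realType) (X Y : normedModType R)
    (f : X -> Y) (x y : X) :
  bijective f -> (forall a b, `|f a - f b| = `|a - b|) ->
  f (2^-1 *: (x + y)) = 2^-1 *: (f x + f y).
Proof.
move=> [g fK gK] fiso; apply/eqP; rewrite -subr_eq0 -normr_eq0.
set c := `|_|; rewrite eq_le normr_ge0 andbT leNgt; apply/negP => c0.
have bound n : 2 ^+ n * c <= `|x - y| by apply: bij_isometry_defect fK gK fiso.
pose n := Num.truncn (`|x - y| / c).
have := bound n.+1; apply/negP; rewrite -ltNge -ltr_pdivrMr//.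
apply: lt_trans (truncnS_gt _) _.
by rewrite -/n -natrX ltr_nat ltn_expl.
Qed.

Lemma homogeneous_isometry_linear (R : realType) (X Y : normedModType R) (f : X -> Y) :
  bijective f -> (forall a b, `|f a - f b| = `|a - b|) ->
  (forall t x, 0 <= t -> f (t *: x) = t *: f x) -> linear f.
Proof.
move=> fbij fiso fZ.
have fD x y : f (x + y) = f x + f y.
  have := bij_isometry_midpoint x y fbij fiso.
  rewrite fZ ?invr_ge0// => /scalerI; apply.
  by rewrite invr_eq0 pnatr_eq0.
have f0 : f 0 = 0 by have := fZ 0 0 (lexx 0); rewrite !scale0r.
have fN x : f (- x) = - f x.
  by apply/eqP; rewrite -addr_eq0 -fD addNr f0.
move=> a x y; rewrite fD; congr (_ + _).
have [a0|a0] := leP 0 a; first exact: fZ.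
by rewrite -[a]opprK scaleNr fN fZ ?scaleNr// oppr_ge0 ltW.
Qed.

(** * Extending isometries of the sphere *)

(** Prolonging the segment from [q] to [p] beyond [p], the norm becomes
eventually larger than [|q|], hence equal to it somewhere in between. *)
Lemma extend_to_sphere (R : realType) (Y : normedModType R) (p q : Y) :
  `|p| <= `|q| -> exists z : Y, `|z| = `|q| /\ `|q - z| = `|q - p| + `|p - z|.
Proof.
move=> pq; have [<-|npq] := eqVneq p q.
  by exists p; rewrite subrr normr0 addr0.
have d0 : 0 < `|p - q| by rewrite normr_gt0 subr_eq0.
pose phi (t : R) : R := `|q + t *: (p - q)|.
(* At this parameter the point is at distance at least [2 |q|] from [q]. *)
pose b : R := 1 + 2 * `|q| / `|p - q|.
have b1 : 1 <= b by rewrite lerDl divr_ge0// mulr_ge0.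
have phic : continuous phi.
  move=> t; apply: cvg_norm; apply: cvgD; first exact: cvg_cst.
  by apply: cvgZr_tmp; exact: cvg_id.
have phi1 : phi 1 = `|p| by rewrite /phi scale1r addrC subrK.
have phib : `|q| <= phi b.
  have := ler_normB (q + b *: (p - q)) q; rewrite addrAC subrr add0r -/(phi b).
  rewrite normrZ ger0_norm ?(le_trans ler01)// /b mulrDl divfK ?gt_eqF// mul1r.
  by have := ltW d0; lra.
have [|t] := @IVT R phi 1 b `|q| b1 (continuous_subspaceT phic).
  by rewrite ge_min le_max phi1 pq phib orbT.
rewrite in_itv /= => /andP[t1 _] phit.
exists (q + t *: (p - q)); split=> //.
have -> : q - (q + t *: (p - q)) = - (t *: (p - q)) by rewrite opprD addrA subrr add0r.
have -> : p - (q + t *: (p - q)) = (1 - t) *: (p - q).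
  by rewrite opprD addrA scalerBl scale1r.
rewrite normrN !normrZ ger0_norm ?(le_trans ler01)// ler0_norm ?subr_le0//.
by rewrite [`|q - p|]distrC; lra.
Qed.

(** Assume [|f x| <= |f y|] and prolong the segment from [f y] to [f x] up to a
point [z] with [|z| = |f y|].  The inverse [g] of [f] preserves the distance
from [f y] to [z], and does not increase the distances from [f y] to [f x] and
from [f x] to [z], which sum to it; so it preserves them. *)
Lemma noncontracting_isometry (R : realType) (X Y : normedModType R)
    (f : X -> Y) (g : Y -> X) :
  cancel g f -> (forall x, `|f x| = `|x|) ->
  (forall x y, `|x| = `|y| -> `|f x - f y| = `|x - y|) ->
  (forall x y, `|x - y| <= `|f x - f y|) ->
  forall x y, `|f x - f y| = `|x - y|.
Proof.
move=> gK fn fs fnc.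
suff main x y : `|x| <= `|y| -> `|f x - f y| = `|x - y|.
  move=> x y; have [|/ltW yx] := leP `|x| `|y|; first exact: main.
  by rewrite distrC main// distrC.
move=> xy; have [|z [zq qz]] := @extend_to_sphere _ _ (f x) (f y).
  by rewrite !fn.
apply/eqP; rewrite eq_le fnc andbT.
have h1 : `|y - g z| = `|f y - z|.
  by rewrite -fs ?gK// -[RHS]fn gK zq fn.
have h2 : `|x - g z| <= `|f x - z| by rewrite -[in leRHS](gK z).
have := ler_normD (y - x) (x - g z); rewrite addrA addrNK h1 qz.
by rewrite [`|y - x|]distrC [`|f y - f x|]distrC; lra.
Qed.

(** Unit vectors with [|T u - T v| ~ 2] satisfy [|T u - l *: T v| ~ 1 + l]: for
[l <= 1] compare [T u - l *: T v] with [T u - T v], otherwise with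
[l *: (T u - T v)]; in both cases they differ by [`|1 - l|] in norm. *)
Lemma sphere_isometry_noncontracting (R : realType) (X Y : normedModType R) (T : X -> Y) :
  has_opposite_pairs X ->
  (forall x, `|x| = 1 -> `|T x| = 1) ->
  (forall x y, `|x| = 1 -> `|y| = 1 -> `|T x - T y| = `|x - y|) ->
  forall x y l, `|x| = 1 -> `|y| = 1 -> 0 <= l ->
  `|x - l *: y| <= `|T x - l *: T y|.
Proof.
move=> opp T1 Tiso x y l x1 y1 l0.
have [->|xy] := eqVneq x (l *: y); first by rewrite subrr normr0.
apply/ler_addgt0Pr => e e0.
have c0 : 0 < 2 + l by lra.
have [||||| u [v [u1 v1 uv xuyv]]] := opp x y l (e / (2 + l)) => //.
  by rewrite divr_gt0.
have uvl : 1 + l - (1 + l) * (e / (2 + l)) <= `|T u - l *: T v|.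
  have Tuv : 2 - e / (2 + l) <= `|T u - T v| by rewrite Tiso.
  have el : 0 <= e / (2 + l) by rewrite divr_ge0 ?ltW.
  have lel : 0 <= l * (e / (2 + l)) by rewrite mulr_ge0.
  have [l1|l1] := leP l 1.
    have := ler_normB (T u - l *: T v) ((1 - l) *: T v).
    rewrite normrZ (T1 v)// mulr1 ger0_norm ?subr_ge0//.
    have -> : T u - l *: T v - (1 - l) *: T v = T u - T v.
      by rewrite scalerBl scale1r opprB addrA addrNK.
    lra.
  have := ler_normB (T u - l *: T v) ((1 - l) *: T u).
  rewrite normrZ (T1 u)// mulr1 ltr0_norm ?subr_lt0//.
  have -> : T u - l *: T v - (1 - l) *: T u = l *: (T u - T v).
    by rewrite scalerBl scale1r opprB addrC addrA subrK scalerBr.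
  rewrite normrZ ger0_norm//.
  have := ler_wpM2l l0 Tuv; lra.
have := ler_normD (T x - l *: T y) ((T u - T x) + l *: (T y - T v)).
have -> : T x - l *: T y + (T u - T x + l *: (T y - T v)) = T u - l *: T v.
  by rewrite scalerBr addrACA [T x + _]addrC subrK addKr.
have := ler_normD (T u - T x) (l *: (T y - T v)).
rewrite normrZ ger0_norm// !Tiso// [`|u - x|]distrC.
have : (2 + l) * (e / (2 + l)) = e by rewrite mulrC divfK ?gt_eqF.
lra.
Qed.

Lemma opposite_pairs_MUP (R : realType) (X : completeNormedModType R) :
  has_opposite_pairs X -> has_MUP X.
Proof.
move=> opp Y T [Tsub Tinj Tsurj] Tiso.
have T1 x : `|x| = 1 -> `|T x| = 1 by move=> x1; apply: Tsub.
pose U (x : X) : Y := `|x| *: T (`|x|^-1 *: x).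
have unit (Z : normedModType R) (z : Z) : z != 0 -> `| `|z|^-1 *: z| = 1.
  by move=> z0; rewrite normrZ normfV normr_id mulVf// normr_eq0.
have U0 : U 0 = 0 by rewrite /U normr0 scale0r.
have UT x : `|x| = 1 -> U x = T x by move=> x1; rewrite /U x1 invr1 !scale1r.
have Un x : `|U x| = `|x|.
  have [->|x0] := eqVneq x 0; first by rewrite U0 !normr0.
  by rewrite normrZ normr_id T1 ?mulr1//; apply: unit.
have UZ t x : 0 <= t -> U (t *: x) = t *: U x.
  rewrite le_eqVlt => /predU1P[<-|t0]; first by rewrite !scale0r U0.
  rewrite /U normrZ gtr0_norm// [RHS]scalerA; congr (_ *: T _).
  by rewrite scalerA invfM mulrAC mulVf ?mul1r// gt_eqF.
have UE x : x != 0 -> exists x', [/\ `|x'| = 1, x = `|x| *: x' & U x = `|x| *: T x'].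
  move=> x0; exists (`|x|^-1 *: x); split=> //; first exact: unit.
  by rewrite scalerA divff ?scale1r// normr_eq0.
have Us x y : `|x| = `|y| -> `|U x - U y| = `|x - y|.
  have [->|x0] := eqVneq x 0.
    by rewrite normr0 => /esym/eqP; rewrite normr_eq0 => /eqP ->; rewrite U0 !subrr !normr0.
  have [->|y0] := eqVneq y 0.
    by rewrite U0 !subr0 Un.
  move=> xy; have [x' [x'1 xE UxE]] := UE x x0; have [y' [y'1 yE UyE]] := UE y y0.
  have -> : x - y = `|y| *: (x' - y') by rewrite scalerBr -{1}xy -xE -yE.
  by rewrite UxE UyE xy -scalerBr !normrZ Tiso.
have Unc x y : `|x - y| <= `|U x - U y|.
  have [->|x0] := eqVneq x 0; first by rewrite U0 !sub0r !normrN Un.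
  have [->|y0] := eqVneq y 0; first by rewrite U0 !subr0 Un.
  have nx0 : 0 < `|x| by rewrite normr_gt0.
  have [x' [x'1 xE UxE]] := UE x x0; have [y' [y'1 yE UyE]] := UE y y0.
  have factor (Z : normedModType R) (a b : Z) :
      `|x| *: a - `|y| *: b = `|x| *: (a - (`|y| / `|x|) *: b).
    by rewrite scalerBr scalerA mulrC divfK// gt_eqF.
  have -> : x - y = `|x| *: (x' - (`|y| / `|x|) *: y') by rewrite -factor -xE -yE.
  rewrite UxE UyE factor !normrZ normr_id ler_wpM2l//.
  by apply: sphere_isometry_noncontracting; rewrite ?divr_ge0.
have /choice[V UV] (y : Y) : exists x, U x = y.
  have [->|y0] := eqVneq y 0; first by exists 0.
  have [x x1 Tx] := Tsurj _ (unit _ _ y0).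
  by exists (`|y| *: x); rewrite UZ// UT// Tx scalerA divff ?scale1r// normr_eq0.
have Uiso := noncontracting_isometry UV Un Us Unc.
have VU : cancel U V.
  move=> x; apply/eqP; rewrite -subr_eq0 -normr_eq0 -Uiso UV.
  by rewrite subrr normr0.
have Ubij : bijective U by exists V.
have Ulin := homogeneous_isometry_linear Ubij Uiso UZ.
pose L : {linear X -> Y} := HB.pack U (GRing.isLinear.Build _ _ _ _ _ Ulin).
by exists L.
Qed.

Theorem mainTheorem4 (R : realType) (X : completeNormedModType R) :
  is_GL (dual_space (dual_space X)) -> has_MUP X.
Proof. by move=> /bidual_GL_opposite_pairs; exact: opposite_pairs_MUP. Qed.
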